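(* Let $r:\mathbb R\to(0,\infty)$ be continuous and let $0\le q\in L_1^{\rm loc}(\mathbb R)$. Suppose that there exists $a\in(0,\infty)$ such that $$\inf_{x\in\mathbb R}\int_{x-a}^{x+a}\frac{q(t)}{r(t)}\,dt>0 .$$ Then the problem $$-r(x)y'(x)+q(x)y(x)=f(x),\quad x\in\mathbb R,\qquad \lim_{|x|\to\infty}y(x)=0$$ is correctly solvable in $C(\mathbb R)$ if and only if $$\lim_{|x|\to\infty}\int_{x-d(x)}^{x+d(x)}\frac{dt}{r(t)}=0 .$$ Moreover, with an absolute constant $c>0$, $$\|G\|_{C(\mathbb R)\to C(\mathbb R)}\le c\sup_{x\in\mathbb R}\int_{x-d(x)}^{x+d(x)}\frac{dt}{r(t)} .$$
   Context: $C(\mathbb R)$ is the space of bounded continuous functions on $\mathbb R$ with the supremum norm. A solution of the problem (for given $f\in C(\mathbb R)$) is any function $y$ on $\mathbb R$, absolutely continuous on every compact interval, that satisfies the differential equation almost everywhere on $\mathbb R$ and satisfies $y(x)\to0$ as $|x|\to\infty$. The problem is called correctly solvable in $C(\mathbb R)$ if (I) for every $f\in C(\mathbb R)$ there exists a unique solution $y\in C(\mathbb R)$, and (II) there is a constant $c'\in(0,\infty)$, independent of $f$, such that $\|y\|_{C(\mathbb R)}\le c'\|f\|_{C(\mathbb R)}$ for all $f\in C(\mathbb R)$. For $x\in\mathbb R$, $d(x)=\inf\{d>0:\int_{x-d}^{x+d}\frac{q(t)}{r(t)}dt=2\}$ (well defined when $\int_{-\infty}^0\frac{q(t)}{r(t)}dt=\infty$,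 which is the case under the hypothesis of the theorem). $G$ is the integral operator $(Gf)(x)=\int_x^\infty\frac{1}{r(t)}\exp\big(-\int_x^t\frac{q(s)}{r(s)}ds\big)f(t)\,dt$, $x\in\mathbb R$, and $\|G\|_{C(\mathbb R)\to C(\mathbb R)}$ is its operator norm on $C(\mathbb R)$. *)

(* Defs.v *)
From HB Require Import structures.
From mathcomp Require Import all_boot all_order all_algebra.
From mathcomp Require Import all_classical all_reals all_analysis.

Set Implicit Arguments.
Unset Strict Implicit.
Unset Printing Implicit Defensive.

Import Order.TTheory GRing.Theory Num.Theory.
Import numFieldNormedType.Exports.

Local Open Scope classical_set_scope.
Local Open Scope ring_scope.

Section Defs.
Context {R : realType}.
Implicit Types (r q f y : R -> R) (x : R).

Local Notation mu := (@lebesgue_measure R).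

(* Membership in C(R), the space of bounded continuous functions. *)
Definition in_CR f : Prop := continuous f /\ bounded_fun f.

(* The supremum is taken in R: it is the norm only for f in C(R). *)
Definition supnorm f : R := sup (range (fun x => `|f x|)).

Definition vanishes_at_infinity f : Prop :=
  f x @[x --> +oo] --> (0 : R) /\ f x @[x --> -oo] --> (0 : R).

Definition absolutely_continuous_on (a b : R) f : Prop :=
  forall eps : R, 0 < eps -> exists2 delta : R, 0 < delta &
    forall (n : nat) (u v : 'I_n -> R),
      (forall i, a <= u i /\ u i <= v i /\ v i <= b) ->
      trivIset setT (fun i => [set` `]u i, v i[]) ->
      \sum_(i < n) (v i - u i) < delta ->
      \sum_(i < n) `|f (v i) - f (u i)| < eps.

Definition locally_absolutely_continuous f : Prop :=
  forall a b : R, a <= b -> absolutely_continuous_on a b f.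

(* Solutions of - r y' + q y = f on R with y(x) --> 0 as |x| --> oo. *)
Definition is_solution r q f y : Prop :=
  [/\ locally_absolutely_continuous y,
      {ae mu, forall x, derivable y x 1 /\
                        - r x * (y^`())%classic x + q x * y x = f x}
    & vanishes_at_infinity y].

Definition correctly_solvable r q : Prop :=
  (forall f, in_CR f -> exists! y, in_CR y /\ is_solution r q f y) /\
  (exists2 c' : R, 0 < c' &
    forall f y, in_CR f -> in_CR y -> is_solution r q f y ->
      supnorm y <= c' * supnorm f).

Definition int_centered (g : R -> R) x (d : R) : R :=
  \int[mu]_(t in `[x - d, x + d]) g t.

Definition dfun r q x : R :=
  inf [set d : R | 0 < d /\ int_centered (fun t => q t / r t) x d = 2].

Definition int_inv_r r q x : R :=
  int_centered (fun t => (r t)^-1) x (dfun r q x).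

Definition G_integrand r q f x (t : R) : R :=
  (r t)^-1 * expR (- \int[mu]_(s in `[x, t]) (q s / r s)) * f t.

Definition G_op r q f x : R :=
  \int[mu]_(t in `[x, +oo[) G_integrand r q f x t.

(* G is an everywhere defined operator C(R) -> C(R) bounded by K.  The
   integrability clause is needed because the real-valued integral in G_op
   takes a junk value on non-integrable functions. *)
Definition G_bounded_by r q (K : R) : Prop :=
  forall f, in_CR f ->
    [/\ forall x, mu.-integrable `[x, +oo[ (EFin \o G_integrand r q f x),
        in_CR (G_op r q f)
      & supnorm (G_op r q f) <= K * supnorm f].

(* Operator norm of G on C(R); it is +oo (the infimum of the empty set) when
   G is not a bounded operator from C(R) to C(R). *)
Definition G_norm r q : \bar R :=
  ereal_inf [set K%:E | K in [set K : R | 0 <= K /\ G_bounded_by r q K]].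

End Defs.

(* Main.v *)
Require Import Defs.
From HB Require Import structures.
From mathcomp Require Import all_boot all_order all_algebra.
From mathcomp Require Import all_classical all_reals all_analysis.
From mathcomp Require Import measurable_realfun ring lra.

Set Implicit Arguments.
Unset Strict Implicit.
Unset Printing Implicit Defensive.

Import Order.TTheory GRing.Theory Num.Theory.
Import numFieldNormedType.Exports.

Local Open Scope classical_set_scope.
Local Open Scope ring_scope.

(** Write p = q / r, let P be an antiderivative of p, and put
    k = exp(- P) / r.  Since exp(- P) is an integrating factor, every solution
    of - r y' + q y = f satisfies (y exp(- P))' = - k f almost everywhere, and
    y exp(- P) is locally absolutely continuous; hence
    y exp(- P) + \int k f is a constant ([solution_const]).  The passage from
    the almost everywhere identity to the constant is
    [ac_derive0_eq]: a locally absolutely continuous function whose derivative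
    vanishes almost everywhere is constant.  As P tends to +oo at +oo, a
    solution that vanishes there is unique, and it has to be
    G f (x) = exp(P x) \int_x^oo k f.

    Everything is thus reduced to comparing the tails \int_x^oo k with
    A(x) = \int_(x - d(x))^(x + d(x)) 1 / r.  The window hypothesis gives a
    length 2 D such that every interval of that length carries p-mass at least
    2 ([mass_two_length]), so d <= D.  Starting from x, let z be the first
    point at which the p-mass of [x, z] reaches 2.  Because z is the first
    such point, [x, z] is exactly the interval [m - d(m), m + d(m)] around its
    midpoint m ([mass_two_step]), so that the integral of 1 / r over it is
    A(m), and the integral of k over it is at most exp(- P x) A(m).
    Repeating the step multiplies the weight exp(- P) by exp(- 2) each time,
    and the resulting geometric series gives
    exp(P x) \int_x^oo k <= 2 sup A.  This is the norm estimate, with absolute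
    constant 2 ([G_bounded]).

    If A vanishes at infinity, it is bounded, and the same series shows that
    G f vanishes: at +oo all the values of A that occur are small; at -oo
    finitely many steps stay in the region where A is small, each of them
    having length at most 2 D, and the rest of the series carries a small
    factor exp(- 2 n) ([tail_le_two_scales]).  Conversely, the solution y for
    f = 1 satisfies y (x - d(x)) >= exp(- 2) A(x), since the weight decreases
    by a factor exp(- 2) over [x - d(x), x + d(x)]; as d <= D, the decay of y
    forces that of A ([vanishing_of_correctly_solvable]). *)

(** * Primitives of locally integrable functions *)

Section Primitive.
Context {R : realType}.
Implicit Types (g h : R -> R) (a b c x : R).
Local Notation mu := (@lebesgue_measure R).

Definition segment_integrable g := forall a b, mu.-integrable `[a, b] (EFin \o g).

(** Oriented integral from 0: for each x at most one of the two terms is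
    nonzero. *)
Definition primitive g x : R :=
  \int[mu]_(t in `[0, x]) g t - \int[mu]_(t in `[x, 0]) g t.

Lemma continuous_segment_integrable g : continuous g -> segment_integrable g.
Proof.
move=> cg a b; apply: continuous_compact_integrable; first exact: segment_compact.
exact: continuous_subspaceT.
Qed.

Lemma Rintegral_split g a b c : segment_integrable g -> a <= b -> b <= c ->
  \int[mu]_(t in `[a, c]) g t =
  \int[mu]_(t in `[a, b]) g t + \int[mu]_(t in `[b, c]) g t.
Proof.
move=> ig ab bc.
have := @Rintegral_itvB R g (BLeft a) (BRight c) b (ig _ _).
rewrite !bnd_simp => /(_ ab bc) /eqP; rewrite subr_eq => /eqP ->.
rewrite addrC; congr (_ + _); apply: Rintegral_itv_obnd_cbnd.
apply: integrableS (ig b c) => //; exact: subset_itv_oc_cc.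
Qed.

Lemma Rintegral_itv0 g a b : b <= a -> \int[mu]_(t in `[a, b]) g t = 0.
Proof.
rewrite le_eqVlt => /predU1P[->|ba]; first by rewrite set_itv1 Rintegral_set1.
by rewrite set_itv_ge ?Rintegral_set0// bnd_simp -ltNge.
Qed.

(** The three cases, according to the position of 0, all reduce to additivity
    over adjacent segments. *)
Lemma primitive_itv g a b : segment_integrable g -> a <= b ->
  \int[mu]_(t in `[a, b]) g t = primitive g b - primitive g a.
Proof.
move=> ig ab; rewrite /primitive.
have [a0|/ltW a0] := leP 0 a.
  rewrite (Rintegral_split ig a0 ab) (Rintegral_itv0 g a0).
  rewrite (Rintegral_itv0 g (le_trans a0 ab)); lra.
rewrite (Rintegral_itv0 g a0).
have [b0|/ltW b0] := leP 0 b.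
  rewrite (Rintegral_split ig a0 b0) (Rintegral_itv0 g b0); lra.
rewrite (Rintegral_split ig ab b0) (Rintegral_itv0 g b0); lra.
Qed.

(** Near x the primitive differs by a constant from the integral with fixed
    lower endpoint x - 1, to which the differentiation theorem applies. *)
Lemma is_derive_primitive g x : segment_integrable g -> lebesgue_pt g x ->
  is_derive x 1 (primitive g) (g x).
Proof.
move=> ig gx.
pose F y := \int[mu]_(t in `[x - 1, y]) g t.
have [dF F'] : derivable F x 1 /\ (F^`())%classic x = g x.
  apply: (@FTC1_lebesgue_pt _ g (BLeft (x - 1)) x (x + 1)) => //.
  - by rewrite ltrDl.
  - by rewrite (@lte_fin R) ltrBlDr ltrDl.
have {dF F'} dF : is_derive x 1 F (g x) by apply: DeriveDef; [exact: dF|rewrite -derive1E].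
apply: (@near_eq_is_derive _ _ _ (F \+ cst (primitive g (x - 1)))).
  near=> y; rewrite /F /= primitive_itv ?subrK//.
  by near: y; apply: lt_le_nbhsr; rewrite ltrBlDr ltrDl.
by rewrite -[X in is_derive _ _ _ X]addr0; exact: is_deriveD.
Unshelve. all: by end_near. Qed.

Lemma is_derive_primitive_continuous g x : continuous g -> is_derive x 1 (primitive g) (g x).
Proof.
move=> cg; apply: is_derive_primitive; first exact: continuous_segment_integrable.
apply: (@continuous_lebesgue_pt _ g x setT) => //; last exact: cg.
- by split => //; exact: openT.
- exact: continuous_measurable_fun.
Qed.

(** Absolute continuity of the integral, applied to the union of the given
    disjoint intervals. *)
Lemma primitive_ac g : segment_integrable g -> locally_absolutely_continuous (primitive g).
Proof.
move=> ig a b ab eps e0.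
have igab : mu.-integrable setT (EFin \o (g \_ `[a, b])).
  rewrite -restrict_EFin; apply: (iffLR (integrable_mkcond _ _)).
    exact: measurable_itv.
  exact: ig.
have [d [d0 Hd]] := integral_normr_continuous igab e0.
exists d => // n u v uv tuv suv.
pose I i := [set` `]u i, v i[].
have mI i : measurable (I i) by exact: measurable_itv.
have muI i : mu (I i) = (v i - u i)%:E.
  rewrite /I lebesgue_measure_itv /= lte_fin.
  have [_ [uvi _]] := uv i.
  move: uvi; rewrite le_eqVlt => /predU1P[->|->]; last by rewrite EFinB.
  by rewrite ltxx subrr.
pose D := \big[setU/set0]_(i < n) I i.
have mD : measurable D by apply: bigsetU_measurable.
have muD : (mu D < d%:E)%E.
  rewrite /D (measure_bigsetU_ord _ xpredT)//.
  rewrite (_ : (\sum_(i < n) _)%E = (\sum_(i < n) (v i - u i))%:E) ?lte_fin//.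
  by rewrite -sumEFin; apply: eq_bigr => i _; exact: muI.
apply: le_lt_trans (Hd _ mD muD).
pose h := g \_ `[a, b].
have ih E : measurable E -> mu.-integrable E (EFin \o (fun x => `|h x|)).
  by move=> mE; apply: (@integrable_norm _ _ _ mu); apply: integrableS igab.
have -> : \int[mu]_(x in D) `|h x| = \sum_(i < n) \int[mu]_(x in I i) `|h x|.
  apply: EFin_inj; rewrite /Rintegral fineK; last exact: integrable_fin_num (ih _ mD).
  rewrite integral_bigsetU_EFin //; last 3 first.
  - exact: index_enum_uniq.
  - exact: sub_trivIset tuv.
  - exact: measurable_int (ih _ mD).
  rewrite -sumEFin; apply: eq_bigr => i _.
  by apply/esym/fineK/integrable_fin_num/ih; exact: mI.
apply: ler_sum => i _.
have [aui [uvi vib]] := uv i.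
rewrite /I; have iu : mu.-integrable `]u i, v i[ (EFin \o g).
  by apply: integrableS (ig (u i) (v i)) => //; exact: subset_itv_oo_cc.
rewrite -primitive_itv// -Rintegral_itv_obnd_cbnd; last first.
  by apply: integrableS (ig (u i) (v i)) => //; exact: subset_itv_oc_cc.
rewrite -Rintegral_itv_bndo_bndc//.
rewrite (le_trans (le_normr_Rintegral _ iu))//.
rewrite le_eqVlt; apply/orP; left; apply/eqP.
apply: eq_Rintegral => t; rewrite inE /I /= in_itv /= => /andP[ut tv].
rewrite /h patchE mem_set//= in_itv/=; apply/andP; split.
  exact: le_trans aui (ltW ut).
exact: le_trans (ltW tv) vib.
Qed.
End Primitive.

(** * Absolutely continuous functions *)

Section AbsoluteContinuity.
Context {R : realType}.
Implicit Types (f g h : R -> R) (a b c x y : R).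
Local Notation mu := (@lebesgue_measure R).

Lemma ac_on_dist a b f : absolutely_continuous_on a b f ->
  forall eps : R, 0 < eps -> exists2 delta : R, 0 < delta &
    forall u v, a <= u -> u <= v -> v <= b -> v - u < delta ->
      `|f v - f u| < eps.
Proof.
move=> acf eps /acf[d d0 H]; exists d => // u v au uv vb vud.
have := H 1%N (fun=> u) (fun=> v); rewrite !big_ord1; apply => //.
by apply/trivIsetP => i j _ _; rewrite !ord1 eqxx.
Qed.

Lemma ac_continuous f : locally_absolutely_continuous f -> continuous f.
Proof.
move=> acf x; apply/cvgrPdist_lt => eps e0.
have x1 : x - 1 <= x + 1 by lra.
have [d d0 H] := ac_on_dist (acf _ _ x1) e0.
near=> y.
have yx : `|y - x| < d by rewrite distrC; near: y; exact: cvgr_dist_lt.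
have yx1 : `|y - x| < 1 by rewrite distrC; near: y; exact: cvgr_dist_lt.
have [xy|/ltW xy] := leP x y.
  rewrite distrC; apply: H => //; first lra.
    by have := ler_norm (y - x); lra.
  by have := ler_norm (y - x); lra.
apply: H => //; rewrite distrC in yx yx1; have := ler_norm (x - y); lra.
Unshelve. all: by end_near. Qed.

Lemma continuous_bounded_itv f a b : continuous f ->
  exists2 M : R, 0 <= M & forall x, a <= x <= b -> `|f x| <= M.
Proof.
move=> cf; have [ab|ba] := leP a b; last first.
  by exists 0 => // x /andP[ax xb]; have := lt_le_trans ba (le_trans ax xb); rewrite ltxx.
have cn : {within `[a, b], continuous (fun x => `|f x|)}.
  apply: continuous_subspaceT => x; apply: continuous_comp; first exact: cf.
  exact: norm_continuous.
have [c _ Hc] := EVT_max ab cn.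
exists `|f c| => // x xab; apply: Hc; by rewrite in_itv.
Qed.

(** Common source of the closure properties below: increments dominated by
    those of two absolutely continuous functions. *)
Lemma ac_on_dominated a b f g h C : 0 <= C ->
  absolutely_continuous_on a b f -> absolutely_continuous_on a b g ->
  (forall u v, a <= u -> u <= v -> v <= b ->
    `|h v - h u| <= C * (`|f v - f u| + `|g v - g u|)) ->
  absolutely_continuous_on a b h.
Proof.
move=> C0 acf acg H eps e0.
have e1 : 0 < eps / (2 * (C + 1)) by apply: divr_gt0 => //; lra.
have [d1 d10 H1] := acf _ e1; have [d2 d20 H2] := acg _ e1.
exists (Num.min d1 d2); first by rewrite lt_min d10.
move=> n u v uv tuv; rewrite lt_min => /andP[s1 s2].
have {}H1 := H1 _ _ _ uv tuv s1; have {}H2 := H2 _ _ _ uv tuv s2.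
apply: (@le_lt_trans _ _ (C * (\sum_(i < n) `|f (v i) - f (u i)| +
                               \sum_(i < n) `|g (v i) - g (u i)|))).
  rewrite -big_split mulr_sumr; apply: ler_sum => i _.
  have [? [? ?]] := uv i; exact: H.
apply: (@le_lt_trans _ _ (C * (eps / (2 * (C + 1)) + eps / (2 * (C + 1))))).
  by rewrite ler_wpM2l// ltW// ltrD.
have -> : C * (eps / (2 * (C + 1)) + eps / (2 * (C + 1))) = eps * (C / (C + 1)).
  by field; apply/eqP; lra.
by rewrite gtr_pMr// ltr_pdivrMr; lra.
Qed.

Lemma acD f g : locally_absolutely_continuous f ->
  locally_absolutely_continuous g ->
  locally_absolutely_continuous (fun x => f x + g x).
Proof.
move=> acf acg a b ab; apply: ac_on_dominated (acf a b ab) (acg a b ab) _; first exact: ler01.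
move=> u v _ _ _; rewrite mul1r (le_trans _ (ler_normD _ _))//.
by rewrite le_eqVlt; apply/orP; left; apply/eqP; congr `|_|; lra.
Qed.

Lemma acM f g : locally_absolutely_continuous f ->
  locally_absolutely_continuous g ->
  locally_absolutely_continuous (fun x => f x * g x).
Proof.
move=> acf acg a b ab.
have [M M0 HM] := continuous_bounded_itv a b (ac_continuous acf).
have [N N0 HN] := continuous_bounded_itv a b (ac_continuous acg).
apply: (@ac_on_dominated _ _ f g _ (M + N)) (acf a b ab) (acg a b ab) _; first lra.
move=> u v au uv vb.
have -> : f v * g v - f u * g u = (f v - f u) * g v + f u * (g v - g u) by ring.
rewrite (le_trans (ler_normD _ _))// !normrM mulrDr lerD//.
  rewrite mulrC ler_wpM2r//; have := HN v; rewrite vb (le_trans au)// => /(_ isT); lra.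
rewrite ler_wpM2r//; have := HM u; rewrite au (le_trans uv)// => /(_ isT); lra.
Qed.

Lemma expR_lipschitz (M s t : R) : s <= M -> t <= M ->
  `|expR s - expR t| <= expR M * `|s - t|.
Proof.
wlog ts : s t / t <= s => [H|sM tM].
  have [/H|/ltW/H] := leP t s; first exact.
  by move=> H' sM tM; rewrite distrC [`|s - t|]distrC; exact: H'.
rewrite !ger0_norm ?subr_ge0 ?ler_expR//.
apply: (@le_trans _ _ (expR s * (s - t))); last first.
  by rewrite ler_wpM2r ?subr_ge0// ler_expR.
have := expR_ge1Dx (t - s); rewrite expRD expRN => H.
have es := expR_gt0 s.
have : expR s * (1 + (t - s)) <= expR s * (expR t / expR s) by rewrite ler_pM2l.
by rewrite [X in _ <= X]mulrC divfK ?gt_eqF//; lra.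
Qed.

Lemma ac_expR f : locally_absolutely_continuous f ->
  locally_absolutely_continuous (fun x => expR (f x)).
Proof.
move=> acf a b ab.
have [M M0 HM] := continuous_bounded_itv a b (ac_continuous acf).
apply: (@ac_on_dominated _ _ f f _ (expR M)) (acf a b ab) (acf a b ab) _.
  exact: expR_ge0.
move=> u v au uv vb; rewrite (le_trans (@expR_lipschitz M _ _ _ _))//.
- rewrite (le_trans (ler_norm _))// HM// vb (le_trans au)//.
- rewrite (le_trans (ler_norm _))// HM// au (le_trans uv)//.
- by rewrite ler_wpM2l ?expR_ge0// lerDl.
Qed.

Lemma ac_cst c : locally_absolutely_continuous (fun=> c : R).
Proof.
move=> a b ab eps e0; exists 1 => // n u v _ _ _.
by rewrite big1// => i _; rewrite subrr normr0.
Qed.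

(** Cousin's lemma in relational form: a transitive relation that holds between
    the ends of every short segment around each point holds between the ends
    of every segment.  The supremum of the points reachable from a is reachable,
    and cannot be less than b. *)
Lemma cousin (Q : R -> R -> Prop) a b : a <= b ->
  (forall x y z, Q x y -> Q y z -> Q x z) ->
  (forall t, exists2 eta : R, 0 < eta &
     forall x y, t - eta < x -> x <= t -> t <= y -> y < t + eta -> Q x y) ->
  Q a b.
Proof.
move=> ab Qtrans Qloc.
pose S := [set x | a <= x <= b /\ Q a x].
have Qrefl t : Q t t.
  have [e e0] := Qloc t; apply; lra.
have Sa : S a by split; rewrite ?lexx.
have hS : has_sup S by split; [exists a|exists b => x [/andP[]]].
pose s := sup S.
have as_ : a <= s by apply: ub_le_sup => //; case: hS.
have sb : s <= b by apply: ge_sup; [exists a|move=> x [/andP[]]].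
have [e e0 H] := Qloc s.
have [x [/andP[ax xb] Qax] sx] := sup_adherent e0 hS.
have ubS := hS.2.
have xs : x <= s by apply: ub_le_sup => //; split; rewrite ?ax.
have Qas : Q a s by apply: Qtrans Qax _; apply: H => //; lra.
have [bs|sltb] := leP b s.
  by have -> : b = s by apply/eqP; rewrite eq_le bs sb.
pose y := Num.min b (s + e / 2).
have sy : s < y by rewrite /y lt_min sltb; lra.
have yb : y <= b by rewrite /y ge_min lexx.
have ye : y <= s + e / 2 by rewrite /y ge_min lexx orbT.
have Say : S y.
  split; first by rewrite yb andbT; lra.
  by apply: Qtrans Qas _; apply: H; lra.
have : y <= s by apply: ub_le_sup.
lra.
Qed.
End AbsoluteContinuity.

(** * A vanishing derivative almost everywhere *)

Section ZeroDerivative.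
Context {R : realType}.
Implicit Types (f g h : R -> R) (a b c x y : R) (U : set R) (s : seq (R * R)).
Local Notation mu := (@lebesgue_measure R).

(** Finite families of successive intervals inside U, between x and y.  Ordered
    lists are used because they concatenate, unlike the families indexed by
    ordinals in terms of which absolute continuity is defined. *)
Fixpoint chain U x y s : Prop :=
  if s is p :: s' then
    [/\ x <= p.1, p.1 <= p.2, [set` `]p.1, p.2[] `<=` U & chain U p.2 y s']
  else x <= y.

Lemma chain_le U x y s : chain U x y s -> x <= y.
Proof.
by elim: s x => [//|p s ih] x /= [xp pp _ /ih]; move/(le_trans pp)/(le_trans xp).
Qed.

Lemma chain_cat U x y z s t : chain U x y s -> chain U y z t ->
  chain U x z (s ++ t).
Proof.
elim: s x => [|p s ih] x /=; last by move=> [xp pp pU /ih H] /H.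
case: t => [|p t] /= xy; first exact: le_trans.
by move=> [yp pp pU ct]; split => //; exact: le_trans yp.
Qed.

Lemma chain_nth U x y s i : chain U x y s -> (i < size s)%N ->
  [/\ x <= (nth (0, 0) s i).1, (nth (0, 0) s i).1 <= (nth (0, 0) s i).2 &
      (nth (0, 0) s i).2 <= y].
Proof.
elim: s x i => [//|p s ih] x [|i] /= [xp pp pU cs].
  by split => //; exact: chain_le cs.
move=> /(ih _ _ cs)[pi ii iy]; split => //.
exact: le_trans xp (le_trans pp pi).
Qed.

Lemma chain_sub U x y s i : chain U x y s -> (i < size s)%N ->
  [set` `](nth (0, 0) s i).1, (nth (0, 0) s i).2[] `<=` U.
Proof.
elim: s x i => [//|p s ih] x [|i] /= [_ _ pU cs] // si.
exact: ih cs si.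
Qed.

Lemma chain_sorted U x y s i j : chain U x y s -> (i < j)%N -> (j < size s)%N ->
  (nth (0, 0) s i).2 <= (nth (0, 0) s j).1.
Proof.
elim: s x i j => [//|p s ih] x i [//|j] /= [_ _ _ cs].
case: i => [|i] /= ij js; first by have [] := chain_nth cs js.
exact: (ih _ _ _ cs).
Qed.

(** Successive intervals are disjoint since their ends are ordered. *)
Lemma chain_trivIset U x y s : chain U x y s ->
  trivIset setT (fun i : 'I_(size s) =>
    [set` `](nth (0, 0) s i).1, (nth (0, 0) s i).2[]).
Proof.
move=> cs; apply/trivIsetP => /= i j _ _.
wlog ij : i j / (i < j)%N => [H|_].
  rewrite neq_ltn => /orP[ij|ji]; first by apply: H => //; rewrite neq_ltn ij.
  by rewrite setIC; apply: H => //; rewrite neq_ltn ji.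
rewrite -subset0 => z /= [] /[!in_itv]/= /andP[_ zi] /andP[jz _].
have := chain_sorted cs ij (ltn_ord j).
by move=> /(lt_le_trans zi)/lt_trans/(_ jz); rewrite ltxx.
Qed.

(** The intervals of a chain are disjoint subsets of U: the total length is
    small as soon as U has small measure. *)
Lemma chain_measure U x y s : measurable U -> chain U x y s ->
  ((\sum_(p <- s) (p.2 - p.1))%:E <= mu U)%E.
Proof.
move=> mU cs.
pose u i := (nth (0, 0) s i).1; pose v i := (nth (0, 0) s i).2.
pose I (i : 'I_(size s)) := [set` `]u i, v i[].
have mI i : measurable (I i) by exact: measurable_itv.
have muI i : mu (I i) = (v i - u i)%:E.
  rewrite /I lebesgue_measure_itv /= lte_fin.
  have [_ uvi _] := chain_nth cs (ltn_ord i).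
  move: uvi; rewrite -/(u i) -/(v i) le_eqVlt => /predU1P[->|->]; last by rewrite EFinB.
  by rewrite ltxx subrr.
have -> : (\sum_(p <- s) (p.2 - p.1))%:E = mu (\big[setU/set0]_(i < size s) I i).
  rewrite (measure_bigsetU_ord _ xpredT)//; last exact: chain_trivIset cs.
  rewrite (big_nth (0, 0)) big_mkord -sumEFin; apply: eq_bigr => i _.
  by rewrite -muI.
have mB : measurable (\big[setU/set0]_(i < size s) I i) by exact: bigsetU_measurable.
have BU : \big[setU/set0]_(i < size s) I i `<=` U.
  apply: (big_ind (fun B => B `<=` U)) => // [B B' BU BU'|i _].
    by rewrite subUset.
  exact: chain_sub cs (ltn_ord i).
by apply: le_measure => //; rewrite inE.
Qed.

Lemma ac_chain a b f (eps : R) : absolutely_continuous_on a b f -> 0 < eps ->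
  exists2 delta : R, 0 < delta & forall U s, chain U a b s ->
    \sum_(p <- s) (p.2 - p.1) < delta ->
    \sum_(p <- s) `|f p.2 - f p.1| < eps.
Proof.
move=> acf /acf[d d0 H]; exists d => // U s cs sd.
rewrite (big_nth (0, 0)) big_mkord.
apply: (H _ (fun i : 'I_(size s) => (nth (0, 0) s i).1)
            (fun i : 'I_(size s) => (nth (0, 0) s i).2)).
- by move=> i; have [] := chain_nth cs (ltn_ord i).
- exact: chain_trivIset cs.
- by move: sd; rewrite (big_nth (0, 0)) big_mkord.
Qed.

Lemma is_derive0_near f (t eps : R) : is_derive t 1 f 0 -> 0 < eps ->
  exists2 eta : R, 0 < eta & forall y, `|y - t| < eta ->
    `|f y - f t| <= eps * `|y - t|.
Proof.
move=> [df f0] e0.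
move: df => /cvg_ex[l dl].
have l0 : l = 0 by rewrite -f0; apply/esym/cvg_lim.
move: dl; rewrite {}l0 => /cvgrPdist_le/(_ _ e0); rewrite near_withinE => -[eta /= eta0 H].
exists eta => // y yt.
have [->|ne] := eqVneq y t; first by rewrite !subrr normr0 mulr0.
have /= := H (y - t); rewrite sub0r normrN => /(_ yt).
rewrite subr_eq0 => /(_ ne).
rewrite sub0r normrN normrM [_ *: 1]mulr1 subrK normfV.
by rewrite ler_pdivrMl ?normr_gt0 ?subr_eq0// mulrC.
Qed.

(** The exceptional null set is enclosed in an open set U of measure so small
    that chains in U contribute less than eps to the variation of f.  By
    Cousin's lemma, [a, b] can be cut into segments that either lie in U or on
    which f moves by at most eps times the length. *)
Lemma ac_derive0_eq f a b : locally_absolutely_continuous f ->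
  {ae mu, forall x, is_derive x 1 f 0} -> a <= b -> f b = f a.
Proof.
move=> acf [N [mN muN fN]] ab.
suff H (eps : R) : 0 < eps -> `|f b - f a| <= eps * (b - a) + eps.
  apply/eqP; rewrite -subr_eq0 -normr_le0; apply/ler_addgt0Pr => e e0.
  rewrite add0r.
  have b1 : 0 < b - a + 1 by lra.
  have /H : 0 < e / (b - a + 1) by exact: divr_gt0.
  have -> // : e / (b - a + 1) * (b - a) + e / (b - a + 1) = e.
  by field; apply/eqP; lra.
move=> e0.
have [d d0 Hd] := ac_chain (acf a b ab) e0.
have muNy : (mu N < +oo)%E by rewrite muN ltry.
have [U [oU NU UNd]] := lebesgue_regularity_outer mN muNy d0.
have mU : measurable U by exact: open_measurable.
have mUd : (mu U < d%:E)%E.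
  rewrite -(setDUK NU) measureU// ?setDIK//; last exact: measurableD.
  change (mu N + mu (U `\` N) < d%:E)%E.
  by rewrite muN add0e.
pose Q x y := exists2 s, chain U x y s &
  `|f y - f x| <= eps * (y - x) + \sum_(p <- s) `|f p.2 - f p.1|.
have [s cs fs] : Q a b.
  apply: cousin => // [x y z|t].
    move=> [s cs fs] [s' cs' fs']; exists (s ++ s'); first exact: chain_cat cs cs'.
    rewrite big_cat/=; have := ler_normD (f z - f y) (f y - f x).
    rewrite addrA subrK; lra.
  have [Nt|Nt] := pselect (N t).
    have /nbhs_ballP[e /= eg0 eU] : nbhs t U by apply: open_nbhs_nbhs; split => //; exact: NU.
    exists e => // x y tx xt ty yt; exists [:: (x, y)] => /=.
      split => //; first exact: le_trans xt ty.
      move=> z /=; rewrite in_itv/= => /andP[xz zy]; apply: eU.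
      by rewrite /ball/= ltr_norml; lra.
    rewrite big_seq1 /= lerDr mulr_ge0// ?subr_ge0 ?(le_trans xt ty)//; exact: ltW.
  have ft : is_derive t 1 f 0 by apply: contrapT => nf; apply/Nt/fN.
  have [e eg0 H] := is_derive0_near ft e0.
  exists e => // x y tx xt ty yt; exists [::]; first exact: le_trans xt ty.
  rewrite big_nil addr0.
  have H1 := H x; have H2 := H y.
  have := ler_normD (f y - f t) (f t - f x).
  rewrite addrA subrK [`|f t - f x|]distrC.
  rewrite ler0_norm ?subr_le0// in H1.
  rewrite ger0_norm ?subr_ge0// in H2.
  have {}H1 := H1 ltac:(lra); have {}H2 := H2 ltac:(lra); lra.
rewrite (le_trans fs)// lerD2l ltW//; apply: (Hd _ _ cs).
by rewrite -lte_fin; apply: le_lt_trans mUd; exact: chain_measure cs.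
Qed.
End ZeroDerivative.

(** * Integrals over half-lines, first hitting points, bounded functions *)

Section Auxiliary.
Context {R : realType}.
Implicit Types (f g h : R -> R) (a b c x y : R).
Local Notation mu := (@lebesgue_measure R).

Lemma primitive_le g h a b : segment_integrable g -> segment_integrable h -> a <= b ->
  (forall t, a <= t <= b -> g t <= h t) ->
  primitive g b - primitive g a <= primitive h b - primitive h a.
Proof.
by move=> ig ih ab gh; rewrite -!primitive_itv//; apply: le_Rintegral.
Qed.

Lemma primitiveZ c g x : segment_integrable g -> primitive (fun t => c * g t) x = c * primitive g x.
Proof.
by move=> ig; rewrite /primitive mulrBr; congr (_ - _); apply: RintegralZl.
Qed.

(** Monotone convergence along the segments [x, x + n]. *)
Lemma ge0_integral_itvy_le g x (K : R) : continuous g -> (forall t, 0 <= g t) ->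
  (forall b, x <= b -> primitive g b - primitive g x <= K) ->
  (\int[mu]_(t in `[x, +oo[) (g t)%:E <= K%:E)%E.
Proof.
move=> cg g0 gK.
have mg A : measurable A -> measurable_fun A (EFin \o g).
  move=> mA; apply/measurable_EFinP; apply: measurable_funS (continuous_measurable_fun cg) => //.
rewrite itv_bndy_bigcup_BRight.
have H : (\int[mu]_(t in `[x, (x + i%:R)%R]) (g t)%:E)%E @[i --> \oo] -->
   (\int[mu]_(t in \bigcup_i `[x, (x + i%:R)%R]%classic) (g t)%:E)%E.
  apply: ge0_nondecreasing_set_cvg_integral => //.
  - apply/nondecreasing_seqP => n; rewrite subsetEset; apply: subset_itvl.
    by rewrite bnd_simp lerD2l ler_nat.
  - by move=> i; exact: mg.
  - by move=> i t _; rewrite lee_fin.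
rewrite -(cvg_lim _ H)//; apply: lime_le; first by apply/cvg_ex; eexists; exact: H.
apply: nearW => n; have xn : x <= x + n%:R by rewrite lerDl.
have ig := @continuous_segment_integrable R g cg x (x + n%:R).
rewrite -[leLHS]fineK; last exact: integrable_fin_num.
by rewrite lee_fin -/(Rintegral _ _ _) primitive_itv//;
  [exact: gK|exact: continuous_segment_integrable].
Qed.

Lemma integrable_itvy g h x (K : R) : continuous g -> continuous h -> (forall t, `|g t| <= h t) ->
  (forall b, x <= b -> primitive h b - primitive h x <= K) ->
  mu.-integrable `[x, +oo[ (EFin \o g) /\
  `|\int[mu]_(t in `[x, +oo[) g t| <= K.
Proof.
move=> cg ch gh hK.
have cn : continuous (fun t => `|g t|).
  by move=> t; apply: continuous_comp; [exact: cg|exact: norm_continuous].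
have K_ : (\int[mu]_(t in `[x, +oo[) `|g t|%:E <= K%:E)%E.
  apply: ge0_integral_itvy_le => // b xb; apply: le_trans (hK _ xb).
  apply: primitive_le => //; exact: continuous_segment_integrable.
have ig : mu.-integrable `[x, +oo[ (EFin \o g).
  apply/integrableP; split.
    by apply/measurable_EFinP; apply: measurable_funS (continuous_measurable_fun cg).
  by apply: le_lt_trans K_ _; rewrite ltry.
split => //; rewrite (le_trans (le_normr_Rintegral _ ig))//.
rewrite -lee_fin /Rintegral fineK//.
exact: integrable_fin_num (integrable_norm ig).
Qed.

Lemma Rintegral_itvy_split g x y : mu.-integrable `[x, +oo[ (EFin \o g) -> segment_integrable g ->
  x <= y -> \int[mu]_(t in `[y, +oo[) g t =
    \int[mu]_(t in `[x, +oo[) g t - (primitive g y - primitive g x).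
Proof.
move=> ig lg xy; rewrite -primitive_itv//.
have := @Rintegral_itvB R g (BLeft x) +oo%O y ig.
rewrite bnd_simp => /(_ xy isT) ->.
apply/esym/Rintegral_itv_obnd_cbnd; apply: integrableS ig => //.
by apply: subset_itvr; rewrite bnd_simp.
Qed.

Lemma inf_eq (S : set R) (z : R) : S z -> (forall d, S d -> z <= d) -> inf S = z.
Proof.
move=> Sz zS; apply/eqP; rewrite eq_le; apply/andP; split.
  by apply: ge_inf => //; exists z.
by apply: lb_le_inf => //; exists z.
Qed.

(** The infimum z of the points where f reaches v; the intermediate value
    theorem on [x, z] excludes f z > v. *)
Lemma first_hit f x b (v : R) : continuous f -> f x < v -> x <= b -> v <= f b ->
  exists z, [/\ x < z, z <= b, f z = v & forall t, x <= t -> t < z -> f t < v].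
Proof.
move=> cf fxv xb vfb.
pose S := [set t | x <= t <= b /\ v <= f t].
have Sb : S b by split; rewrite ?xb ?lexx.
have hS : has_inf S by split; [exists b|exists x => t [/andP[]]].
pose z := inf S.
have xz : x <= z by apply: lb_le_inf; [exists b|move=> t [/andP[]]].
have zb : z <= b by apply: ge_inf => //; case: hS.
have vz : v <= f z.
  rewrite leNgt; apply/negP => fzv.
  have : \forall t \near z, f t < v by exact: (cvgr_lt _ (cf z)).
  move=> /nbhs_ballP[e /= e0 H].
  have [t [xtb vt] tz] := inf_adherent e0 hS.
  have zt : z <= t by apply: ge_inf => //; case: hS.
  have : f t < v by apply: H; rewrite /ball /= ler0_norm; rewrite -/z in tz; lra.
  by rewrite ltNge vt.
have lt t : x <= t -> t < z -> f t < v.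
  move=> xt tz; rewrite ltNge; apply/negP => vt.
  have : z <= t.
    apply: ge_inf; first by case: hS.
    by split => //; rewrite xt (le_trans (ltW tz)).
  by rewrite leNgt tz.
exists z; split => //.
  rewrite lt_neqAle xz andbT; apply: contraPneq vz => <-.
  by apply/negP; rewrite -ltNge.
have [||c] := @IVT R f x z v xz; first exact: continuous_subspaceT.
  by rewrite ge_min le_max vz (ltW fxv) orbT.
rewrite in_itv/= => /andP[xc cz] fc.
move: cz; rewrite le_eqVlt => /predU1P[<-//|/(lt _ xc)].
by rewrite fc ltxx.
Qed.

Lemma vanishes_at_infinityP f : vanishes_at_infinity f <->
  forall eps : R, 0 < eps -> exists T : R, forall x, T <= `|x| -> `|f x| <= eps.
Proof.
split.
  move=> [/cvgrPdist_le fp /cvgrPdist_le fm] eps e0.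
  have [M [_ HM]] := fp _ e0; have [N [_ HN]] := fm _ e0.
  exists (Num.max (`|M| + 1) (`|N| + 1)) => x.
  rewrite ge_max => /andP[Mx Nx].
  have [x0|x0] := leP 0 x.
    rewrite (ger0_norm x0) in Mx.
    have /= := HM x; rewrite sub0r normrN; apply; have := ler_norm M; lra.
  rewrite (ltr0_norm x0) in Nx.
  have /= := HN x; rewrite sub0r normrN; apply; have := ler_norm (- N); rewrite normrN; lra.
move=> H; split; apply/cvgrPdist_le => eps /H[T HT].
  exists (`|T|); split; first exact: num_real.
  move=> x Tx; rewrite /= sub0r normrN; apply: HT.
  by rewrite (le_trans (ler_norm _))// (le_trans (ltW Tx))// ler_norm.
exists (- `|T|); split; first exact: num_real.
move=> x Tx; rewrite /= sub0r normrN; apply: HT.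
rewrite -normrN (le_trans (ler_norm _))// (le_trans _ (ler_norm _))//.
by rewrite lerNr ltW.
Qed.

Lemma in_CR_le_supnorm f x : in_CR f -> `|f x| <= supnorm f.
Proof.
move=> [_ [M [_ HM]]]; apply: ub_le_sup; last by exists x.
exists (`|M| + 1) => _ [t _ <-]; apply: HM => //.
by rewrite (le_lt_trans (ler_norm M))// ltrDl.
Qed.

Lemma supnorm_le f (K : R) : (forall x, `|f x| <= K) -> supnorm f <= K.
Proof. by move=> fK; apply: ge_sup; [exists `|f 0|; exists 0|move=> _ [x _ <-]]. Qed.

Lemma in_CRP f (K : R) : continuous f -> (forall x, `|f x| <= K) -> in_CR f.
Proof.
move=> cf fK; split => //; exists K; split; first exact: num_real.
by move=> M KM x _; exact: le_trans (fK x) (ltW KM).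
Qed.

End Auxiliary.

(** * Elementary estimates *)

(** One more term of the geometric series: the constant 2 S reproduces itself
    because the weight is at least halved, S + 2 S / 2 = 2 S. *)
Lemma geometric_step (R : realType) (fx fz fz' ex ez S : R) : 0 <= S ->
  fz - fx <= ex * S -> fz' - fz <= 2 * S * ez -> ez * 2 <= ex ->
  fz' - fx <= 2 * S * ex.
Proof.
move=> S0 H1 H2 H3.
have : S * (ez * 2) <= S * ex by rewrite ler_wpM2l.
lra.
Qed.

Lemma two_scale_sum (R : realType) (fx fz fm fb ex en S eps : R) :
  fb <= fm -> fz - fx <= 2 * eps * ex -> fm - fz <= 2 * S * (ex * en) ->
  fb - fx <= (2 * eps + 2 * S * en) * ex.
Proof. lra. Qed.

Lemma expRN_small (R : realType) (S c : R) : 0 <= S -> 0 < c ->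
  exists n : nat, 2 * S * expR (- (2 * n%:R)) <= c / 2.
Proof.
move=> S0 c0; pose n := Num.bound (4 * S / c); exists n.
have nb : 4 * S / c < n%:R.
  by apply: archi_boundP; apply: divr_ge0; [exact: mulr_ge0|exact: ltW].
have ex : 1 + 2 * n%:R <= expR (2 * n%:R) :> R by exact: expR_ge1Dx.
rewrite expRN ler_pdivrMr ?expR_gt0//.
rewrite ltr_pdivrMr// in nb.
have : c / 2 * (1 + 2 * n%:R) <= c / 2 * expR (2 * n%:R).
  by apply: ler_wpM2l => //; apply: divr_ge0 => //; exact: ltW.
apply: le_trans; have : 0 <= c * n%:R by apply: mulr_ge0 => //; exact: ltW.
lra.
Qed.

(** * The integrating factor and the function d *)

Section Problem.
Context {R : realType}.
Implicit Types (f g h : R -> R) (a b c x y t : R).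
Local Notation mu := (@lebesgue_measure R).
Context (r q : R -> R).
Context (cr : continuous r) (r0 : forall x, 0 < r x).
Context (lq : locally_integrable [set: R] q)
  (q0 : {ae mu, forall x, 0 <= q x}).

Let w t := (r t)^-1.
Let p t := q t / r t.

Lemma continuous_inv_r : continuous (fun t => (r t)^-1).
Proof. by move=> x; apply: cvgV; [rewrite gt_eqF|exact: cr]. Qed.

Lemma measurable_quotient : measurable_fun setT (fun t => q t / r t).
Proof.
have [mq _ _] := lq.
by apply: measurable_funM => //; exact: continuous_measurable_fun continuous_inv_r.
Qed.

(** 1 / r is bounded on segments. *)
Lemma segment_integrable_quotient : segment_integrable (fun t => q t / r t).
Proof.
move=> a b; have [mq _ iq] := lq.
have iqab : mu.-integrable `[a, b] (EFin \o q).
  apply/integrableP; split.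
    by apply/measurable_EFinP; apply: measurable_funS mq.
  by apply: iq => //; exact: segment_compact.
have := @integrableMl _ _ _ mu `[a, b]%classic (measurable_itv _) (EFin \o q) w iqab.
apply.
  exact: measurable_funS (continuous_measurable_fun continuous_inv_r).
have [M M0 HM] := continuous_bounded_itv a b continuous_inv_r.
exists M; split; first exact: num_real.
move=> N MN x /=; rewrite in_itv /= => xab.
exact: le_trans (HM _ xab) (ltW MN).
Qed.

Let P := primitive p.

Lemma locally_integrable_quotient : locally_integrable [set: R] (fun t => q t / r t).
Proof.
split; [exact: measurable_quotient|exact: openT|move=> K _ cK].
have [M [_ HM]] := compact_bounded cK.
have KM : K `<=` `[- (`|M| + 1), `|M| + 1].
  move=> x /(HM (`|M| + 1)); rewrite (le_lt_trans (ler_norm M)) ?ltrDl// => /(_ isT) xM.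
  by rewrite /= in_itv/= -ler_norml.
have /integrableP[_] := segment_integrable_quotient (- (`|M| + 1)) (`|M| + 1).
apply: le_lt_trans; apply: ge0_subset_integral => //=.
  exact: compact_measurable.
apply/measurable_EFinP; apply: measurableT_comp => //.
exact: measurable_funS measurable_quotient.
Qed.

Lemma ae_is_derive_P : {ae mu, forall x, is_derive x 1 (primitive p) (p x)}.
Proof.
have := lebesgue_differentiation locally_integrable_quotient.
apply: filterS; first exact: (ae_filter_ringOfSetsType mu).
by move=> x; apply: is_derive_primitive; exact: segment_integrable_quotient.
Qed.

Lemma P_ndecr x y : x <= y -> P x <= P y.
Proof.
move=> xy; rewrite -subr_ge0 -primitive_itv//; last exact: segment_integrable_quotient.
have -> : \int[mu]_(t in `[x, y]) p t = \int[mu]_(t in `[x, y]) `|p t|.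
  congr fine; apply: ae_eq_integral => //.
  - by apply/measurable_EFinP; apply: measurable_funS measurable_quotient.
  - apply/measurable_EFinP; apply: measurableT_comp => //.
    exact: measurable_funS measurable_quotient.
  - apply: filterS q0; first exact: (ae_filter_ringOfSetsType mu).
    move=> t qt _; rewrite /=.
    by rewrite ger0_norm// /p divr_ge0// ltW.
by apply: Rintegral_ge0.
Qed.

Lemma ac_P : locally_absolutely_continuous P.
Proof. exact: primitive_ac segment_integrable_quotient. Qed.

Lemma continuous_P : continuous P.
Proof. exact: ac_continuous ac_P. Qed.

Lemma P_lt x y : P x < P y -> x < y.
Proof. by rewrite ltNge => /negP H; rewrite ltNge; apply/negP => /P_ndecr. Qed.

Lemma int_centered_quotient x (d : R) : 0 <= d ->
  int_centered p x d = P (x + d) - P (x - d).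
Proof.
move=> d0; rewrite /int_centered primitive_itv//; last lra.
exact: segment_integrable_quotient.
Qed.

(* Unification would otherwise unfold primitives down to integrals. *)
Opaque primitive.
Let H := primitive w.

Lemma H_ndecr x y : x <= y -> H x <= H y.
Proof.
move=> xy; rewrite -subr_ge0 -primitive_itv//;
  last exact: continuous_segment_integrable continuous_inv_r.
by apply: Rintegral_ge0 => t _; rewrite invr_ge0 ltW.
Qed.

(** Adjacent windows of length 2 a, each of mass at least delta, are put together. *)
Lemma window_growth a delta : 0 < a -> 0 < delta ->
  (forall x, P (x - a) + delta <= P (x + a)) ->
  exists2 D : R, 0 < D & forall x, P x + 2 <= P (x + 2 * D).
Proof.
move=> a0 d0 win.
have steps n x : P x + n%:R * delta <= P (x + 2 * (a * n%:R)).
  elim: n => [|n ih]; first by rewrite mul0r !mulr0 !addr0.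
  have := win (x + 2 * (a * n%:R) + a).
  rewrite addrK (_ : _ + a + a = x + 2 * (a * n.+1%:R)); last by rewrite -natr1; ring.
  by apply: le_trans; rewrite -natr1 mulrDl mul1r addrA lerD2r.
pose n := (Num.bound (2 / delta)).+1.
have n2 : 2 <= n%:R * delta.
  rewrite -ler_pdivrMr// (le_trans (ltW (archi_boundP _)))//.
    by apply: divr_ge0 => //; exact: ltW.
  by rewrite ler_nat.
exists (a * n%:R) => [|x]; first by rewrite mulr_gt0// ltr0n.
by apply: le_trans (steps n x); rewrite lerD2l.
Qed.

Lemma mass_two_length a : 0 < a ->
  0 < inf (range (fun x => int_centered p x a)) ->
  exists2 D : R, 0 < D & forall x, P x + 2 <= P (x + 2 * D).
Proof.
move=> a0 inf0; apply: (window_growth a0 inf0) => x.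
rewrite addrC -lerBrDr -int_centered_quotient; last exact: ltW.
apply: ge_inf; last by exists x.
exists 0 => _ [z _ <-]; rewrite int_centered_quotient; last exact: ltW.
by rewrite subr_ge0; apply: P_ndecr; lra.
Qed.

Context (D : R) (D0 : 0 < D)
  (PD : forall x, P x + 2 <= P (x + 2 * D)).

(** The infimum defining d is attained, at the first point where the continuous
    function d |-> \int_(x - d)^(x + d) p reaches 2. *)
Lemma dfunP x : let d := dfun r q x in
  [/\ 0 < d, d <= D & P (x + d) - P (x - d) = 2].
Proof.
pose phi d := P (x + d) - P (x - d).
have cphi : continuous phi.
  move=> d; apply: cvgB.
    apply: (@continuous_comp _ _ _ (fun d => x + d) P); last exact: continuous_P.
    by apply: cvgD; [exact: cvg_cst|exact: cvg_id].
  apply: (@continuous_comp _ _ _ (fun d => x - d) P); last exact: continuous_P.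
  by apply: cvgB; [exact: cvg_cst|exact: cvg_id].
have [||d [d0 dD phid dlt]] := @first_hit R phi 0 D 2 cphi _ (ltW D0).
- by rewrite /phi addr0 subr0 subrr.
- have := PD (x - D); rewrite (_ : x - D + 2 * D = x + D) /phi; [lra|ring].
suff -> : dfun r q x = d by [].
apply: inf_eq => /=.
  by split => //; rewrite (int_centered_quotient x (ltW d0)).
move=> e [e0]; rewrite (int_centered_quotient x (ltW e0)) => phie.
rewrite leNgt; apply/negP => /(dlt _ (ltW e0)).
by rewrite /phi phie ltxx.
Qed.

Lemma int_inv_rE x : let d := dfun r q x in
  int_inv_r r q x = H (x + d) - H (x - d).
Proof.
have [d0 _ _] := dfunP x.
rewrite /int_inv_r /int_centered primitive_itv//;
  first exact: continuous_segment_integrable continuous_inv_r.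
rewrite /=; lra.
Qed.

Lemma int_inv_r_ge0 x : 0 <= int_inv_r r q x.
Proof.
have [d0 _ _] := dfunP x; rewrite int_inv_rE subr_ge0; apply: H_ndecr; lra.
Qed.

(** Minimality of z matters: p may vanish near the ends of [x, z], and then a
    later z with P z = P x + 2 would give an interval longer than the one
    that d selects around its midpoint. *)
Lemma mass_two_step x : exists m z : R,
  [/\ x < z, x <= m <= z, z <= x + 2 * D, P z = P x + 2 &
      int_inv_r r q m = H z - H x].
Proof.
have x2D : x <= x + 2 * D by rewrite lerDl mulr_ge0// ltW.
have [|z [xz zD Pz zlt]] := @first_hit R P x (x + 2 * D) (P x + 2) continuous_P _ x2D (PD x).
  lra.
pose m := (x + z) / 2; pose e := (z - x) / 2.
have e0 : 0 < e by rewrite /e; lra.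
have mez : m + e = z by rewrite /m /e; field.
have mex : m - e = x by rewrite /m /e; field.
exists m, z; split => //; first by rewrite /m; lra.
suff dm : dfun r q m = e by rewrite int_inv_rE dm mez mex.
apply: inf_eq => /=.
  by split => //; rewrite (int_centered_quotient m (ltW e0)) mez mex Pz; lra.
move=> d [d0]; rewrite (int_centered_quotient m (ltW d0)) => Pd.
rewrite leNgt; apply/negP => de.
have : P (m + d) < P x + 2 by apply: zlt; lra.
have : P x <= P (m - d) by apply: P_ndecr; lra.
lra.
Qed.

(* The kernel k of the introduction and its primitive. *)
Let e t := expR (- P t) / r t.

Lemma continuous_expNP : continuous (fun t => expR (- P t)).
Proof.
move=> x; apply: continuous_comp; last exact: continuous_expR.
by apply: cvgN; exact: continuous_P.
Qed.

Lemma continuous_kernel : continuous (fun t => expR (- P t) / r t).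
Proof. by move=> x; apply: cvgM; [exact: continuous_expNP|exact: continuous_inv_r]. Qed.

Let F := primitive e.

Lemma kernel_gt0 t : 0 < e t.
Proof. by rewrite divr_gt0 ?expR_gt0. Qed.

Lemma F_ndecr x y : x <= y -> F x <= F y.
Proof.
move=> xy; rewrite -subr_ge0 -primitive_itv//;
  last exact: continuous_segment_integrable continuous_kernel.
by apply: Rintegral_ge0 => t _; rewrite ltW ?kernel_gt0.
Qed.

Lemma F_le x y : x <= y -> F y - F x <= expR (- P x) * (H y - H x).
Proof.
move=> xy; rewrite mulrBr -!primitiveZ; try exact: continuous_segment_integrable continuous_inv_r.
apply: primitive_le.
- exact: continuous_segment_integrable continuous_kernel.
- apply: continuous_segment_integrable => t; apply: cvgM; [exact: cvg_cst|exact: continuous_inv_r].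
- exact: xy.
- move=> t /andP[xt _]; apply: ler_wpM2r; first by rewrite invr_ge0 ltW.
  by rewrite ler_expR lerN2 P_ndecr.
Qed.

Lemma F_ge x y : x <= y -> expR (- P y) * (H y - H x) <= F y - F x.
Proof.
move=> xy; rewrite mulrBr -!primitiveZ; try exact: continuous_segment_integrable continuous_inv_r.
apply: primitive_le.
- apply: continuous_segment_integrable => t; apply: cvgM; [exact: cvg_cst|exact: continuous_inv_r].
- exact: continuous_segment_integrable continuous_kernel.
- exact: xy.
- move=> t /andP[_ ty]; apply: ler_wpM2r; first by rewrite invr_ge0 ltW.
  by rewrite ler_expR lerN2 P_ndecr.
Qed.

(** Geometric series: after each step of p-mass 2 the weight exp(- P) is divided
    by exp 2 >= 2.  The explicit range of t in the hypothesis records how far n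
    steps can reach; it is what makes the estimate usable at -oo. *)
Lemma iterated_mass_two_steps (S : R) n x : 0 <= S ->
  (forall t, x <= t <= x + 2 * D * n%:R -> int_inv_r r q t <= S) ->
  exists z, [/\ x <= z, P z = P x + 2 * n%:R & F z - F x <= 2 * S * expR (- P x)].
Proof.
move=> S0; elim: n x => [|n ih] x HS.
  by exists x; split => //; rewrite ?mulr0 ?addr0// subrr !mulr_ge0// expR_ge0.
have [m [z [xz /andP[xm mz] zD Pz Hz]]] := mass_two_step x.
have n0 : 0 <= 2 * D * n%:R by rewrite !mulr_ge0// ltW.
have nS : 2 * D * n.+1%:R = 2 * D + 2 * D * n%:R by rewrite -natr1; ring.
have [|z' [zz' Pz' Fz']] := ih z.
  by move=> t /andP[zt tn]; apply: HS; lra.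
exists z'; split; first lra.
  by rewrite Pz' Pz -natr1; ring.
have Hm : int_inv_r r q m <= S by apply: HS; lra.
have Fz := F_le (ltW xz); rewrite -Hz in Fz.
have Ex := expR_gt0 (- P x).
have Fz1 : F z - F x <= expR (- P x) * S by rewrite (le_trans Fz)// ler_pM2l.
have E2 : 3 <= expR (2 : R) by apply: le_trans (expR_ge1Dx _); rewrite -[1]/(1%:R) -natrD.
have EP : expR (- P z) * 2 <= expR (- P x).
  rewrite Pz opprD expRD (expRN 2) -[X in _ <= X]mulr1 -mulrA ler_pM2l// mulrC.
  by rewrite ler_pdivrMr ?expR_gt0// mul1r (le_trans _ E2)// ler_nat.
exact: geometric_step S0 Fz1 Fz' EP.
Qed.

Lemma P_unbounded (M : R) x : exists n, M <= P x + 2 * n%:R.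
Proof.
exists (Num.bound `|M - P x|).
have := archi_boundP (normr_ge0 (M - P x)).
have := ler0n R (Num.bound `|M - P x|).
by have := ler_norm (M - P x); lra.
Qed.

Lemma tail_le (S : R) x b : 0 <= S -> x <= b ->
  (forall t, x <= t -> int_inv_r r q t <= S) ->
  F b - F x <= 2 * S * expR (- P x).
Proof.
move=> S0 xb HS; have [n Hn] := P_unbounded (P b + 1) x.
have [z [xz Pz Fz]] := @iterated_mass_two_steps S n x S0 (fun t xt => HS t (andP xt).1).
have bz : b < z by apply: P_lt; lra.
by rewrite (le_trans _ Fz)// lerB// F_ndecr// ltW.
Qed.

(** For x near -oo: the first n steps see values of A at most eps, and what
    follows them is damped by exp(- 2 n). *)
Lemma tail_le_two_scales (S eps : R) n x b : 0 <= S -> 0 <= eps -> x <= b ->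
  (forall t, int_inv_r r q t <= S) ->
  (forall t, x <= t <= x + 2 * D * n%:R -> int_inv_r r q t <= eps) ->
  F b - F x <= (2 * eps + 2 * S * expR (- (2 * n%:R))) * expR (- P x).
Proof.
move=> S0 e0 xb HS Heps.
have [z [xz Pz Fz]] := iterated_mass_two_steps e0 Heps.
have zb' : F b <= F (Num.max z b) by apply: F_ndecr; rewrite le_max lexx orbT.
have zm : z <= Num.max z b by rewrite le_max lexx.
have Ez : expR (- P z) = expR (- P x) * expR (- (2 * n%:R)).
  by rewrite Pz opprD expRD.
have := tail_le S0 zm (fun t _ => HS t); rewrite Ez.
exact: two_scale_sum zb' Fz.
Qed.

(** * The operator G *)

Lemma is_derive_expR_comp g x (dg : R) : is_derive x 1 g dg ->
  is_derive x 1 (fun t => expR (g t)) (expR (g x) * dg).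
Proof.
move=> dgx.
exact: (@is_derive1_comp _ expR g x _ _ (is_derive_expR _) dgx).
Qed.

Lemma continuous_weighted f : continuous f -> continuous (fun t => e t * f t).
Proof. by move=> cf t; apply: cvgM; [exact: continuous_kernel|exact: cf]. Qed.

Lemma integrable_weighted_tail f (M K : R) x : continuous f -> (forall t, `|f t| <= M) ->
  (forall b, x <= b -> F b - F x <= K) ->
  mu.-integrable `[x, +oo[ (EFin \o (fun t => e t * f t)) /\
  `|\int[mu]_(t in `[x, +oo[) (e t * f t)| <= M * K.
Proof.
move=> cf fM FK; have M0 : 0 <= M by apply: le_trans (fM 0).
apply: (@integrable_itvy _ _ (fun t => M * e t)).
- exact: continuous_weighted.
- by move=> t; apply: cvgM; [exact: cvg_cst|exact: continuous_kernel].
- by move=> t; rewrite normrM mulrC (gtr0_norm (kernel_gt0 t)) ler_wpM2r// ltW ?kernel_gt0.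
- move=> b xb; rewrite !primitiveZ; try exact: continuous_segment_integrable continuous_kernel.
  by rewrite -mulrBr ler_wpM2l//; exact: FK.
Qed.

Lemma G_integrandE f x t : x <= t ->
  G_integrand r q f x t = expR (P x) * (e t * f t).
Proof.
move=> xt; rewrite /G_integrand primitive_itv//; last exact: segment_integrable_quotient.
by rewrite opprB addrC expRD /e; ring.
Qed.

Lemma G_opE f x : mu.-integrable `[x, +oo[ (EFin \o (fun t => e t * f t)) ->
  mu.-integrable `[x, +oo[ (EFin \o G_integrand r q f x) /\
  G_op r q f x = expR (P x) * \int[mu]_(t in `[x, +oo[) (e t * f t).
Proof.
move=> ik; rewrite /G_op -RintegralZl//; split; last first.
  apply: eq_Rintegral => t; rewrite inE /= in_itv /= andbT; exact: G_integrandE.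
pose h t := e t * f t.
have ih : mu.-integrable `[x, +oo[ (fun t => (expR (P x))%:E * (EFin \o h) t)%E.
  by apply: integrableZl.
apply: eq_integrable ih => // t; rewrite inE /= in_itv /= andbT => xt.
by rewrite G_integrandE.
Qed.

(** Writing the tail integral as a constant minus a primitive makes regularity
    and the equation for G f a matter of the primitive. *)
Lemma G_op_as_primitive f : continuous f ->
  (forall x, mu.-integrable `[x, +oo[ (EFin \o (fun t => e t * f t))) ->
  exists T : R, forall x, G_op r q f x =
    expR (P x) * (T + -1 * primitive (fun t => e t * f t) x).
Proof.
move=> cf ik; pose k t := e t * f t; pose I x := \int[mu]_(t in `[x, +oo[) k t.
have lk : segment_integrable k by exact: continuous_segment_integrable (continuous_weighted cf).
exists (I 0 + primitive k 0) => x; rewrite (G_opE (ik x)).2 -/(k _) -/(I x); congr (_ * _).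
pose z := Num.min x 0.
have zx : z <= x by rewrite ge_min lexx.
have z0 : z <= 0 by rewrite ge_min lexx orbT.
have := Rintegral_itvy_split (ik z) lk zx; have := Rintegral_itvy_split (ik z) lk z0.
rewrite -/k -/(I x) -/(I 0) -/(I z) => -> ->; ring.
Qed.

Lemma G_op_le f (M c : R) x : continuous f -> (forall t, `|f t| <= M) ->
  (forall b, x <= b -> F b - F x <= c * expR (- P x)) ->
  `|G_op r q f x| <= M * c.
Proof.
move=> cf fM Fc; have [ik Ik] := integrable_weighted_tail cf fM Fc.
rewrite (G_opE ik).2 normrM gtr0_norm ?expR_gt0//.
have := ler_wpM2l (expR_ge0 (P x)) Ik.
have -> // : expR (P x) * (M * (c * expR (- P x))) = M * c.
by rewrite expRN; field; rewrite gt_eqF ?expR_gt0.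
Qed.

Lemma ac_G_op f : continuous f ->
  (forall x, mu.-integrable `[x, +oo[ (EFin \o (fun t => e t * f t))) ->
  locally_absolutely_continuous (G_op r q f).
Proof.
move=> cf ik; have [T ET] := G_op_as_primitive cf ik.
rewrite (funext ET); apply: acM; first exact: ac_expR ac_P.
apply: acD; first exact: ac_cst.
apply: acM; first exact: ac_cst.
exact: primitive_ac (continuous_segment_integrable (continuous_weighted cf)).
Qed.

Lemma G_op_ode f : continuous f ->
  (forall x, mu.-integrable `[x, +oo[ (EFin \o (fun t => e t * f t))) ->
  {ae mu, forall x, derivable (G_op r q f) x 1 /\
    - r x * ((G_op r q f)^`())%classic x + q x * G_op r q f x = f x}.
Proof.
move=> cf ik; have [T ET] := G_op_as_primitive cf ik.
apply: filterS ae_is_derive_P; first exact: (ae_filter_ringOfSetsType mu).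
move=> x dP; rewrite /= derive1E.
pose k t := e t * f t.
have dk : is_derive x 1 (primitive k) (k x).
  exact: is_derive_primitive_continuous (continuous_weighted cf).
have dG : is_derive x 1 (G_op r q f) (p x * G_op r q f x - f x / r x).
  have dE := is_derive_expR_comp dP.
  have dT : is_derive x 1 (fun t => T + -1 * primitive k t) (0 + -1 * k x).
    apply: is_deriveD; exact: is_deriveZ.
  rewrite (funext ET) -/k.
  have dM := is_deriveM dE dT.
  apply: (is_derive_eq dM).
  rewrite /GRing.scale /= /k /e expRN.
  by field; rewrite !gt_eqF ?expR_gt0.
split; first exact: ex_derive.
rewrite derive_val /p.
by field; rewrite gt_eqF.
Qed.

(** * Solutions of the equation *)

(** The product y exp(- P) plus the primitive of k f is absolutely continuous
    and its derivative vanishes wherever the equation holds and P' = p. *)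
Lemma solution_const f (y : R -> R) : continuous f -> locally_absolutely_continuous y ->
  {ae mu, forall x, derivable y x 1 /\ - r x * (y^`())%classic x + q x * y x = f x} ->
  exists C : R, forall x, y x * expR (- P x) + primitive (fun t => e t * f t) x = C.
Proof.
move=> cf acy ode; pose k t := e t * f t.
pose u x := y x * expR (- 1 * P x) + primitive k x.
have acu : locally_absolutely_continuous u.
  apply: acD; last exact: primitive_ac (continuous_segment_integrable (continuous_weighted cf)).
  apply: acM => //; apply: ac_expR; apply: acM ac_P; exact: ac_cst.
have u0 : {ae mu, forall x, is_derive x 1 u 0}.
  have := ae_is_derive_P; apply: filterS2 ode; first exact: (ae_filter_ringOfSetsType mu).
  move=> x [dy oy] dP; rewrite derive1E in oy.
  have dNP : is_derive x 1 (fun t => -1 * P t) (-1 * p x) by exact: is_deriveZ.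
  have dE := is_derive_expR_comp dNP.
  have dk : is_derive x 1 (primitive k) (k x).
    exact: is_derive_primitive_continuous (continuous_weighted cf).
  have dM := is_deriveD (is_deriveM (derivableP dy) dE) dk.
  apply: (is_derive_eq dM).
  rewrite /GRing.scale /= /k /e /p mulN1r.
  have -> : f x = - r x * 'D_1 y x + q x * y x by [].
  by field; rewrite gt_eqF.
exists (u 0) => x.
have -> : u 0 = u x.
  have [x0|/ltW x0] := leP x 0; first exact: ac_derive0_eq acu u0 x0.
  exact/esym/(ac_derive0_eq acu u0 x0).
by rewrite /u mulN1r.
Qed.

(** The difference of two solutions is C exp P, which is bounded away from 0
    on the positive half-line unless C = 0. *)
Lemma solution_unique f (y1 y2 : R -> R) : continuous f ->
  is_solution r q f y1 -> is_solution r q f y2 -> y1 = y2.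
Proof.
move=> cf [ac1 ode1 van1] [ac2 ode2 van2].
have [C1 H1] := solution_const cf ac1 ode1.
have [C2 H2] := solution_const cf ac2 ode2.
pose C := C1 - C2.
have HC x : (y1 x - y2 x) * expR (- P x) = C.
  by rewrite mulrBl /C -(H1 x) -(H2 x); ring.
suff C0 : C = 0.
  apply/funext => x; apply/eqP; rewrite -subr_eq0.
  by have /eqP := HC x; rewrite C0 mulf_eq0 (gt_eqF (expR_gt0 _)) orbF.
apply/eqP; rewrite -normr_le0; apply/ler_addgt0Pr => eps e0; rewrite add0r.
have e1 : 0 < eps / 2 * expR (P 0) by rewrite mulr_gt0 ?divr_gt0 ?expR_gt0.
have [T1 HT1] := (vanishes_at_infinityP _).1 van1 _ e1.
have [T2 HT2] := (vanishes_at_infinityP _).1 van2 _ e1.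
pose x := Num.max 0 (Num.max T1 T2).
have x0 : 0 <= x by rewrite le_max lexx.
have xT1 : T1 <= `|x| by rewrite ger0_norm// !le_max lexx orbT.
have xT2 : T2 <= `|x| by rewrite ger0_norm// !le_max lexx !orbT.
have Y : `|y1 x - y2 x| <= eps * expR (P 0).
  rewrite (le_trans (ler_normB _ _))// (le_trans (lerD (HT1 _ xT1) (HT2 _ xT2)))//.
  by rewrite -mulrDl -splitr.
rewrite -(HC x) normrM (gtr0_norm (expR_gt0 _)).
apply: le_trans (ler_wpM2r (expR_ge0 _) Y) _.
rewrite -mulrA -expRD -[X in _ <= X]mulr1 ler_pM2l// -expR0 ler_expR.
by rewrite subr_le0 P_ndecr.
Qed.

(** On a bounded region the inequality d <= D bounds A by an integral of 1 / r over a fixed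
    segment. *)
Lemma int_inv_r_bounded : vanishes_at_infinity (int_inv_r r q) ->
  exists2 S : R, 0 <= S & forall t, int_inv_r r q t <= S.
Proof.
move=> /vanishes_at_infinityP/(_ 1 ltr01)[T HT].
pose B := H (`|T| + D) - H (- `|T| - D).
have B0 : 0 <= B.
  rewrite subr_ge0; apply: H_ndecr; have := normr_ge0 T; move: D0 => D0' ?; lra.
exists (1 + B) => [|t]; first by rewrite addr_ge0.
have [Tt|tT] := leP `|T| `|t|.
  have := HT t (le_trans (ler_norm T) Tt); have := ler_norm (int_inv_r r q t).
  move: B0; move: B (int_inv_r r q t) `|_| => *; lra.
have [d0 dD _] := dfunP t.
have := ler_norm t; have := ler_norm (- t); rewrite normrN => t1 t2.
have h1 : H (t + dfun r q t) <= H (`|T| + D) by apply: H_ndecr; lra.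
have h2 : H (- `|T| - D) <= H (t - dfun r q t) by apply: H_ndecr; lra.
rewrite int_inv_rE (le_trans (lerB h1 h2))// lerDr//.
Qed.

Lemma G_bounded (S : R) : 0 <= S -> (forall t, int_inv_r r q t <= S) ->
  G_bounded_by r q (2 * S).
Proof.
move=> S0 HS f fCR; have [cf _] := fCR.
have fM t := in_CR_le_supnorm t fCR.
have FS x b : x <= b -> F b - F x <= 2 * S * expR (- P x).
  by move=> xb; apply: tail_le => // t _.
have ik x : mu.-integrable `[x, +oo[ (EFin \o (fun t => e t * f t)).
  exact: (integrable_weighted_tail cf fM (FS x)).1.
have Gle x : `|G_op r q f x| <= 2 * S * supnorm f.
  by rewrite mulrC; apply: G_op_le => // b; exact: FS.
split.
- by move=> x; exact: (G_opE (ik x)).1.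
- by apply: in_CRP Gle; exact: ac_continuous (ac_G_op cf ik).
- exact: supnorm_le.
Qed.

Lemma G_op_vanishes f : in_CR f -> vanishes_at_infinity (int_inv_r r q) ->
  vanishes_at_infinity (G_op r q f).
Proof.
move=> fCR van; have [cf _] := fCR.
have [S S0 HS] := int_inv_r_bounded van.
have fM t := in_CR_le_supnorm t fCR.
have M0 : 0 <= supnorm f by apply: le_trans (fM 0).
apply/vanishes_at_infinityP => eps e0.
pose c := eps / (supnorm f + 1).
have c0 : 0 < c by rewrite divr_gt0// ltr_wpDl.
have Mc : supnorm f * c <= eps.
  by rewrite /c mulrCA ler_piMr ?(ltW e0)// ler_pdivrMr ?ltr_wpDl// mul1r lerDl.
have c4 : 0 < c / 4 by rewrite divr_gt0.
have [T HT] := (vanishes_at_infinityP _).1 van _ c4.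
have [n nS] := expRN_small S0 c0.
have Dn : 0 <= 2 * D * n%:R by rewrite !mulr_ge0// ltW.
exists (`|T| + 2 * D * n%:R) => x Tx.
apply: le_trans Mc; apply: G_op_le => // b xb.
have Heps t : x <= t <= x + 2 * D * n%:R -> int_inv_r r q t <= c / 4.
  move=> /andP[xt tx]; apply: le_trans (ler_norm _) _; apply: HT.
  apply: le_trans (ler_norm T) _.
  move: Dn Tx xt tx; move: (2 * D * n%:R) `|T| => N T' N0.
  have [x0|x0] := leP 0 x.
    by rewrite (ger0_norm x0) => *; apply: le_trans (ler_norm t); lra.
  by rewrite (ltr0_norm x0) -normrN => *; apply: le_trans (ler_norm (- t)); lra.
apply: le_trans (@tail_le_two_scales S (c / 4) n x b S0 (ltW c4) xb HS Heps) _.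
rewrite ler_wpM2r ?expR_ge0//; move: nS; move: (2 * S * _) => s nS.
lra.
Qed.

(** * Correct solvability *)

Lemma correctly_solvable_of_vanishing :
  vanishes_at_infinity (int_inv_r r q) -> correctly_solvable r q.
Proof.
move=> van; have [S S0 HS] := int_inv_r_bounded van.
have GB := G_bounded S0 HS.
have Gsol f : in_CR f -> in_CR (G_op r q f) /\ is_solution r q f (G_op r q f).
  move=> fCR; have [ig GCR _] := GB f fCR; split => //; have [cf _] := fCR.
  have ik x : mu.-integrable `[x, +oo[ (EFin \o (fun t => e t * f t)).
    apply: (integrable_weighted_tail cf (fun t => in_CR_le_supnorm t fCR) _).1 => b xb.
    by apply: (tail_le S0 xb) => t _; exact: HS.
  split; [exact: ac_G_op|exact: G_op_ode|exact: G_op_vanishes].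
split.
  move=> f fCR; exists (G_op r q f); split; first exact: Gsol.
  move=> y [_ soly]; exact: solution_unique (fCR.1) (Gsol f fCR).2 soly.
exists (2 * S + 1); first by rewrite ltr_wpDl// mulr_ge0.
move=> f y fCR yCR soly.
rewrite (solution_unique fCR.1 soly (Gsol f fCR).2).
have [_ _ le] := GB f fCR; apply: (le_trans le).
by rewrite ler_wpM2r ?lerDl// (le_trans (normr_ge0 (f 0)))// in_CR_le_supnorm.
Qed.

(** For f = 1 the constant C of [solution_const] dominates the primitive of k,
    so y exp(- P) = C - \int k bounds the integral of k over
    [x - d(x), x + d(x)] from above by the value of
    y exp(- P) at x - d(x). *)
Lemma vanishing_of_correctly_solvable :
  correctly_solvable r q -> vanishes_at_infinity (int_inv_r r q).
Proof.
move=> [solv _].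
have cf1 : continuous (fun _ : R => 1 : R) by move=> ?; exact: cvg_cst.
have CR1 : in_CR (fun _ : R => 1 : R).
  by apply: (@in_CRP _ _ 1) => // x; rewrite normr1.
have [y [[_ [acy ode van]] _]] := solv _ CR1.
have [C HC] := solution_const cf1 acy ode.
have {}HC x : y x * expR (- P x) + F x = C.
  rewrite -(HC x); congr (_ + primitive _ _); apply/funext => t; by rewrite mulr1.
have FC x : F x <= C.
  apply/ler_addgt0Pr => eps e0.
  have e1 : 0 < eps * expR (P 0) by rewrite mulr_gt0 ?expR_gt0.
  have [T HT] := (vanishes_at_infinityP _).1 van _ e1.
  pose z := Num.max x (Num.max 0 T).
  have z0 : 0 <= z by rewrite !le_max lexx orbT.
  have zT : T <= `|z| by rewrite ger0_norm// !le_max lexx !orbT.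
  have xz : x <= z by rewrite le_max lexx.
  have Fxz := F_ndecr xz.
  have : - (y z * expR (- P z)) <= eps.
    rewrite -mulNr; apply: le_trans (ler_wpM2r (expR_ge0 _) (_ : - y z <= eps * expR (P 0))) _.
      by rewrite (le_trans (ler_norm _))// normrN HT.
    rewrite -mulrA -expRD -[X in _ <= X]mulr1 ler_pM2l// -expR0 ler_expR.
    by rewrite subr_le0 P_ndecr.
  move: Fxz (HC z); move: (F x) (F z) (y z * _) => *; lra.
have Ay x : int_inv_r r q x <= expR 2 * y (x - dfun r q x).
  have [d0 _ Pd] := dfunP x; set d := dfun r q x in d0 Pd *.
  have dd : x - d <= x + d by lra.
  have := F_ge dd; rewrite -int_inv_rE.
  have -> : P (x + d) = 2 + P (x - d) by rewrite -Pd; ring.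
  have Cx := FC (x + d); have := HC (x - d).
  have -> : expR (- (2 + P (x - d))) = (expR 2)^-1 * expR (- P (x - d)).
    by rewrite -expRN -expRD -opprD.
  have E := expR_gt0 (- P (x - d)); have E2 := expR_gt0 (2 : R).
  move=> Hy HA.
  have : (expR 2)^-1 * expR (- P (x - d)) * int_inv_r r q x <= y (x - d) * expR (- P (x - d)).
    by move: HA Hy Cx; move: (F _) (F (x - d)) (_ * _) (_ * _) => *; lra.
  by rewrite mulrAC ler_pM2r// mulrC ler_pdivrMr// mulrC.
apply/vanishes_at_infinityP => eps e0.
have e1 : 0 < eps / expR 2 by rewrite divr_gt0 ?expR_gt0.
have [T HT] := (vanishes_at_infinityP _).1 van _ e1.
exists (T + D) => x Tx; have [d0 dD _] := dfunP x.
rewrite ger0_norm ?int_inv_r_ge0//; apply: le_trans (Ay x) _.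
rewrite mulrC -ler_pdivlMr ?expR_gt0//; apply: le_trans (ler_norm _) _; apply: HT.
have := ler_normD (x - dfun r q x) (dfun r q x).
rewrite subrK (gtr0_norm d0); lra.
Qed.
End Problem.

Theorem theorem2p9 (R : realType) :
  exists2 c : R, 0 < c &
    forall r q : R -> R,
      continuous r -> (forall x, 0 < r x) ->
      locally_integrable [set: R] q ->
      {ae (@lebesgue_measure R), forall x, 0 <= q x} ->
      (exists2 a : R, 0 < a &
         0 < inf (range (fun x => int_centered (fun t => q t / r t) x a))) ->
      (correctly_solvable r q <-> vanishes_at_infinity (int_inv_r r q)) /\
      (G_norm r q <=
         c%:E * ereal_sup (range (fun x => (int_inv_r r q x)%:E)))%E.
Proof.
exists 2 => // r q cr r0 lq q0 [a a0 inf0].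
have [D D0 PD] := mass_two_length cr r0 lq q0 a0 inf0.
split.
  split; first exact: (vanishing_of_correctly_solvable cr r0 lq q0 D0 PD).
  exact: (correctly_solvable_of_vanishing cr r0 lq q0 D0 PD).
set A := (X in ereal_sup X).
have Ale x : ((int_inv_r r q x)%:E <= ereal_sup A)%E.
  by apply: ereal_sup_ubound; exists x.
have A0 : (0 <= ereal_sup A)%E.
  by apply: le_trans (Ale 0); rewrite lee_fin (int_inv_r_ge0 cr r0 lq D0 PD).
case: (ereal_sup A) A0 Ale => [S||] // S0 AS; last first.
  by rewrite gt0_muley ?leey// lte_fin.
rewrite lee_fin in S0; rewrite -EFinM.
apply: ereal_inf_lbound; exists (2 * S) => //; split; first by rewrite mulr_ge0.
exact: (G_bounded cr r0 lq q0 D0 PD S0 AS).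
Qed.
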